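(* Let $\mathcal{B}$ be a totally ordered alphabet and $\mathrm{x}\in\{\mathrm{l},\mathrm{r}\}$. The map $w\mapsto(\mathrm{P}_{\mathrm{xps}}(w),\mathrm{Q}_{\mathrm{xps}}(w))$ is a bijection from the set of $\mathrm{x}$-two-rowed arrays over $\mathcal{B}$ onto the semistandard $\mathrm{x}$PS stable pairs set over $\mathcal{B}$.
   Context: A two-rowed array over $\mathcal{B}$ is a pair $\begin{pmatrix}u\\ v\end{pmatrix}$ of words $u=u_1\cdots u_k$, $v=v_1\cdots v_k$ over $\mathcal{B}$ of the same length. It is an $\mathrm{l}$-two-rowed array if $u_1\le\cdots\le u_k$ and $u_i=u_{i+1}$ implies $v_i\le v_{i+1}$; an $\mathrm{r}$-two-rowed array if $u_1\le\cdots\le u_k$ and $u_i=u_{i+1}$ implies $v_{i+1}\le v_i$. A composition diagram is a finite left-to-right sequence of nonempty bottom-justified columns of boxes; shape = sequence of column lengths; bottom row = lowest boxes. An lps tableau over $\mathcal{B}$: filling with elements of $\mathcal{B}$, each column strictly increasing bottom to top, bottom row weakly increasing left to right. An rps tableau: each column weakly increasing bottom to top, bottom row strictly increasing left to right. ''xPS'' = lps if $\mathrm{x}=\mathrm{l}$, rps if $\mathrm{x}=\mathrm{r}$. A standard PS tableau has pairwise distinct entries, columns strictly increasing bottom to top and bottom row strictly increasing left to right. Extended xPS insertion of $\begin{pmatrix}u\\ v\end{pmatrix}$: build $P,Q$ from empty tableaux; at step $j$, with $r_1,\dots,r_k$ the bottom row of current $P$: lps: if $P$ empty or $r_k\le v_j$,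 add a new rightmost one-box column with $v_j$ to $P$ and one with $u_j$ to $Q$; otherwise, with $m$ least such that $v_j<r_m$, shift all entries of column $m$ of $P$ up one box and put $v_j$ at its bottom, and add a box with $u_j$ on top of column $m$ of $Q$. rps: same with conditions $r_k<v_j$ and $v_j\le r_m$. Results: $\mathrm{P}_{\mathrm{xps}}(w),\mathrm{Q}_{\mathrm{xps}}(w)$. Standardization: $\mathcal{C}(\mathcal{B})=\{a_i:a\in\mathcal{B},i\ge1\}$ with $a_i<c_j$ iff $a<c$, or $a=c$ and $i<j$. For a tableau $R$ over $\mathcal{B}$, $\mathrm{Std}_{\mathrm{l}}(R)$ reads entries column by column left to right, each column top to bottom, replacing the $i$-th occurrence of $a$ by $a_i$; $\mathrm{Std}_{\mathrm{r}}(R)$ reads columns right to left, each column bottom to top. Stable pairs: the column reading $\mathfrak{C}(T)$ reads the columns of $T$ left to right, each from top to bottom. $S'$ is obtained from $S$ by reversing the order of entries in each column. For words $u,t$ of equal length with distinct letters and length-3 permutation patterns $p,q$, $(u,t)$ has a simultaneous occurrence of $(p,q)$ if there exist indices $i$ and $k>i+1$ with $u_iu_{i+1}u_k$ order-isomorphic to $p$ and $t_it_{i+1}t_k$ order-isomorphic to $q$. A pair $(R,S)$ of standard PS tableaux of the same shape is stable if $(\mathfrak{C}(R),\mathfrak{C}(S'))$ has no simultaneous occurrence of $(312,132)$, $(312,231)$ or $(321,132)$. The semistandard $\mathrm{x}$PS stable pairs set over $\mathcal{B}$ is the set of pairs $(P,Q)$ of $\mathrm{x}$PS tableaux over $\mathcal{B}$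 of the same shape such that $(\mathrm{Std}_{\mathrm{x}}(P),\mathrm{Std}_{\mathrm{x}}(Q))$ is a stable pair. *)

(* Defs.v *)
From HB Require Import structures.
From mathcomp Require Import all_boot all_order.
From mathcomp Require Import classical_sets functions.

Set Implicit Arguments.
Unset Strict Implicit.
Unset Printing Implicit Defensive.

Import Order.TTheory.

Local Open Scope order_scope.

Inductive side := Left | Right.

(* A tableau is the left-to-right list of its columns, and each column is
   listed from bottom to top. *)
Definition tableau (A : Type) := seq (seq A).

(* A two-rowed array is the pair (u, v) of its top and bottom words; the
   equality of their lengths is part of is_two_rowed_array. *)
Definition array (A : Type) := (seq A * seq A)%type.

(* The letter a_i is the pair (a, i), in the lexicographic order; standardization
   only produces indices i >= 1. *)
Definition std_letter (d : Order.disp_t) (A : orderType d) := (A *l nat)%type.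

Section Tableaux.
Context {d : Order.disp_t} {A : orderType d}.
Implicit Types (x : side) (T P Q R S : tableau A) (a u v : A) (w : array A).

Definition is_two_rowed_array x w : bool :=
  let second_row v v' := if x is Left then v <= v' else v' <= v in
  (size w.1 == size w.2) &&
  sorted (fun p q : A * A =>
            (p.1 <= q.1) && ((p.1 == q.1) ==> second_row p.2 q.2))
         (zip w.1 w.2).

Definition bottom_row T : seq A := pmap ohead T.

Definition is_composition_diagram T : bool := all (fun c => ~~ nilp c) T.

Definition is_lps_tableau T : bool :=
  [&& is_composition_diagram T, all (sorted <%O) T
    & sorted <=%O (bottom_row T)].

Definition is_rps_tableau T : bool :=
  [&& is_composition_diagram T, all (sorted <=%O) T
    & sorted <%O (bottom_row T)].

Definition is_ps_tableau x T : bool :=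
  if x is Left then is_lps_tableau T else is_rps_tableau T.

Definition is_standard_ps_tableau T : bool :=
  [&& is_composition_diagram T, uniq (flatten T), all (sorted <%O) T
    & sorted <%O (bottom_row T)].

Definition starts_column x P v : bool :=
  if bottom_row P is r1 :: r then
    let rk := last r1 r in if x is Left then rk <= v else rk < v
  else true.

(* 0-based index of the least column m of P with v < r_m (resp. v <= r_m). *)
Definition insertion_column x P v : nat :=
  find (fun r => if x is Left then v < r else v <= r) (bottom_row P).

Definition insert_step x (PQ : tableau A * tableau A) (uv : A * A) :=
  let: (P, Q) := PQ in
  let: (u, v) := uv in
  if starts_column x P v then (rcons P [:: v], rcons Q [:: u])
  else let m := insertion_column x P v in
    (set_nth [::] P m (v :: nth [::] P m),
     set_nth [::] Q m (rcons (nth [::] Q m) u)).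

Definition ext_insertion x w : tableau A * tableau A :=
  foldl (insert_step x) ([::], [::]) (zip w.1 w.2).

Definition Pps x w : tableau A := (ext_insertion x w).1.
Definition Qps x w : tableau A := (ext_insertion x w).2.

(* Replaces the i-th occurrence of a, counted from 1 left to right, by a_i. *)
Definition std_word (s : seq A) : seq (std_letter A) :=
  [seq (p.1, count_mem p.1 (take p.2.+1 s)) | p <- zip s (iota 0 (size s))].

Definition reverse_columns (B : Type) (T : tableau B) : tableau B := map rev T.

(* The tableau is read, the word so obtained is standardized, and its letters
   are put back at the positions from which they were read. *)
Definition std_left T : tableau (std_letter A) :=
  reverse_columns
    (reshape (shape T) (std_word (flatten (reverse_columns T)))).

Definition std_right T : tableau (std_letter A) :=
  rev (reshape (rev (shape T)) (std_word (flatten (rev T)))).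

Definition std_tableau x T : tableau (std_letter A) :=
  if x is Left then std_left T else std_right T.

Definition column_reading T : seq A := flatten (reverse_columns T).

Definition order_isomorphic (s : seq A) (p : seq nat) : Prop :=
  size s = size p /\
  forall a0 i j, (i < size s)%N -> (j < size s)%N ->
    (nth a0 s i < nth a0 s j) = (nth 0 p i < nth 0 p j)%N.

(* The default a0 of nth is irrelevant, since i < i + 1 < k < size s. *)
Definition simultaneous_occurrence (s t : seq A) (p q : seq nat) : Prop :=
  exists (a0 : A) (i k : nat),
    [/\ (i.+1 < k)%N, (k < size s)%N, size t = size s,
        order_isomorphic [:: nth a0 s i; nth a0 s i.+1; nth a0 s k] p
      & order_isomorphic [:: nth a0 t i; nth a0 t i.+1; nth a0 t k] q].

Definition is_stable_pair R S : Prop :=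
  let s := column_reading R in
  let t := column_reading (reverse_columns S) in
  [/\ is_standard_ps_tableau R, is_standard_ps_tableau S, shape R = shape S
    & [/\ ~ simultaneous_occurrence s t [:: 3; 1; 2] [:: 1; 3; 2],
          ~ simultaneous_occurrence s t [:: 3; 1; 2] [:: 2; 3; 1]
        & ~ simultaneous_occurrence s t [:: 3; 2; 1] [:: 1; 3; 2]]].

End Tableaux.

Definition is_semistandard_stable_pair (d : Order.disp_t) (B : orderType d)
    (x : side) (PQ : tableau B * tableau B) : Prop :=
  [/\ is_ps_tableau x PQ.1, is_ps_tableau x PQ.2, shape PQ.1 = shape PQ.2
    & is_stable_pair (std_tableau x PQ.1) (std_tableau x PQ.2)].

Definition two_rowed_arrays (d : Order.disp_t) (B : orderType d) (x : side) :
  set (array B) := [set w | is_two_rowed_array x w]%classic.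
Arguments two_rowed_arrays {d} B x.

Definition semistandard_stable_pairs (d : Order.disp_t) (B : orderType d)
    (x : side) : set (tableau B * tableau B) :=
  [set PQ | is_semistandard_stable_pair x PQ]%classic.
Arguments semistandard_stable_pairs {d} B x.

(* Main.v *)
Require Import Defs.
From mathcomp Require Import all_boot all_order.
From mathcomp Require Import classical_sets functions.

(** Record an insertion by the columns Z of pairs (u, v), each column listed in
order of insertion, so that P and Q are read off Z.  A two-rowed array is a
sorted word of pairs, hence is determined by the multiset of entries of Z:
this gives injectivity.

Write [ltx x] for [<] when x = l and for [<=] when x = r.  Then Z comes from an
array iff every entry r of every column to the right of a column c passes c:
the entry at the bottom of c when r is inserted exists and r does not go below
it.
Conversely the array is recovered by repeatedly removing the largest pair.

Between xPS tableaux, "r passes c" says that no adjacent pair p, q of c has r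
inserted between p and q and below p.  Comparing standardized entries in two
different columns amounts to comparing the original ones by [ltx x], so this is
the avoidance of (312,132) and (321,132) by the standardized pair; avoidance of
(312,231) is then automatic. *)

Set Implicit Arguments.
Unset Strict Implicit.
Unset Printing Implicit Defensive.

Import Order.TTheory.

Local Open Scope order_scope.

(** * Pairwise relations on concatenated, reversed and flattened lists *)

Lemma pairwise_mid (T : eqType) (r : rel T) (s1 s2 : seq T) (y : T) :
  pairwise r (s1 ++ y :: s2) =
  [&& all (r ^~ y) s1, all (r y) s2 & pairwise r (s1 ++ s2)].
Proof.
rewrite !pairwise_cat /= allrel_consr.
by case: (all (r^~ y) s1); case: (allrel r s1 s2); case: (pairwise r s1);
   case: (all (r y) s2).
Qed.

Lemma pairwise_rev (T : Type) (r : rel T) (s : seq T) :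
  pairwise r (rev s) = pairwise (fun y z => r z y) s.
Proof.
elim: s => //= y s IH; rewrite rev_cons pairwise_rcons IH.
by rewrite all_rev.
Qed.

Lemma pairwise_flatten (U : eqType) (r : rel U) (ss : seq (seq U)) :
  pairwise r (flatten ss) = all (pairwise r) ss && pairwise (allrel r) ss.
Proof.
elim: ss => //= c ss IH; rewrite pairwise_cat IH.
have -> : allrel r c (flatten ss) = all (allrel r c) ss.
  elim: ss {IH} => [|c' ss IH] /=; first by rewrite allrel0r.
  by rewrite allrel_catr IH.
by rewrite -!andbA; do !bool_congr.
Qed.

(** * The bumping relation and the order on the entries of an array *)

Section Piles.
Context {d : Order.disp_t} {A : orderType d}.
Implicit Types (x : side) (a b e : A) (p q r : A * A) (c : seq (A * A))
  (Z : seq (seq (A * A))).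

(** The bumping relation: [v] goes below a bottom entry [r] exactly when [ltx x v r]. Columns
    increase along it and bottom rows along the complement of its converse, so both sides share one
    proof. *)
Definition ltx x a b : bool := if x is Left then a < b else a <= b.

Definition array_le x p q : bool :=
  (p.1 <= q.1) &&
  ((p.1 == q.1) ==> (if x is Left then p.2 <= q.2 else q.2 <= p.2)).

Lemma ltx_trans x : transitive (ltx x).
Proof. by case: x; [apply: lt_trans | apply: le_trans]. Qed.

Lemma nltx_trans x : transitive (fun a b => ~~ ltx x b a).
Proof.
case: x => b a e /=; rewrite -?leNgt -?ltNge; first exact: le_trans.
exact: lt_trans.
Qed.

(** A tie in the top row is allowed exactly when [q.2] does not bump [p.2] for l, and exactly when
    it does for r; the strictness or weakness of [ltx x] accounts for both. *)
Lemma array_leE x p q :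
  array_le x p q = if ltx x q.2 p.2 then ltx x p.1 q.1 else ~~ ltx x q.1 p.1.
Proof.
rewrite /array_le.
by case: x => /=; case: (ltgtP p.1 q.1); case: (ltgtP p.2 q.2).
Qed.

Lemma array_le_refl x : reflexive (array_le x).
Proof. by move=> p; rewrite /array_le lexx eqxx; case: x; rewrite lexx. Qed.

Lemma array_le_anti x : antisymmetric (array_le x).
Proof.
move=> [a b] [a' b']; rewrite /array_le /=.
case: (ltgtP a a') => //= -> h; congr pair; apply: le_anti.
by case: x h => // /andP[-> ->].
Qed.

Lemma array_le_trans x : transitive (array_le x).
Proof.
move=> [a b] [a1 b1] [a2 b2]; rewrite /array_le /=.
case: (ltgtP a1 a) => //= [l1 _|<-].
  by move=> /andP[l2 _]; move: (lt_le_trans l1 l2) => l; rewrite ltW // (lt_eqF l).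
case: (ltgtP a1 a2) => //= _.
by case: x => h1 h2; [apply: le_trans h2 | apply: le_trans h1].
Qed.

Lemma array_le_total x : total (array_le x).
Proof.
move=> [a b] [a' b']; rewrite /array_le /=.
by case: (ltgtP a a') => //= _; case: x; apply: le_total.
Qed.

Definition col_rel x p q : bool := ltx x p.1 q.1 && ltx x q.2 p.2.

Lemma col_rel_trans x : transitive (col_rel x).
Proof.
move=> q p r /andP[h1 h2] /andP[h3 h4]; rewrite /col_rel.
by rewrite (ltx_trans h1 h3) (ltx_trans h4 h2).
Qed.

Lemma col_rel_array_le x p q : col_rel x p q -> array_le x p q.
Proof. by rewrite array_leE /col_rel => /andP[-> ->]. Qed.

Lemma col_relE x p q : ltx x q.2 p.2 -> array_le x p q -> col_rel x p q.
Proof. by rewrite array_leE /col_rel => -> ->. Qed.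

(** * Insertion into columns of pairs, and its inverse *)

Definition is_pile x c : bool := ~~ nilp c && pairwise (col_rel x) c.

(* When r is inserted, the entry at the bottom of column c is the last one
   preceding r in the array; r moves past c iff it does not go below it. *)
Definition passes x c r : bool :=
  let k := [seq p <- c | array_le x p r] in
  ~~ nilp k && ~~ ltx x r.2 (last r k).2.

Definition is_good x Z : bool :=
  all (is_pile x) Z && pairwise (fun c c' => all (passes x c) c') Z.

Fixpoint pile_insert x Z p : seq (seq (A * A)) :=
  if Z is c :: Z' then
    if ltx x p.2 (last p c).2 then rcons c p :: Z'
    else c :: pile_insert x Z' p
  else [:: [:: p]].

Lemma perm_pile_insert x Z p :
  perm_eq (flatten (pile_insert x Z p)) (p :: flatten Z).
Proof.
elim: Z => [|c Z IH] //=; case: ifP => _ /=.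
  by rewrite cat_rcons -(cat1s p) perm_catCA.
by rewrite -(cat1s p (c ++ _)) perm_sym perm_catCA perm_cat2l perm_sym.
Qed.

Lemma passes_max x c p : all (array_le x ^~ p) c -> ~~ nilp c ->
  passes x c p = ~~ ltx x p.2 (last p c).2.
Proof. by rewrite /passes => /all_filterP -> ->. Qed.

(** As [p] is largest, only an [r] equal to [p] could meet [p] at the bottom of the enlarged column;
    but [r] passes the old column, while [p] goes below its last entry. *)
Lemma is_good_insert x Z p : all (array_le x ^~ p) (flatten Z) ->
  is_good x Z -> is_good x (pile_insert x Z p).
Proof.
rewrite /is_good; elim: Z => [|c Z IH] //= .
rewrite all_cat => /andP[hc hZ] /andP[/andP[gc gZ] /andP[pc pZ]].
have [nc sc] := andP gc.
case: ifP => lp /=.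
  rewrite gZ pZ !andbT; apply/andP; split.
    rewrite /is_pile pairwise_rcons sc !andbT /nilp size_rcons /=.
    case/lastP: c nc hc lp sc {gc pc} => // c q _ hc.
    rewrite last_rcons pairwise_rcons => lp /andP[hq _].
    have qp : col_rel x q p.
      by apply: col_relE => //; move: hc; rewrite all_rcons => /andP[].
    rewrite all_rcons qp /=; apply/allP => s /(allP hq) sq.
    exact: col_rel_trans sq qp.
  apply/allP => c' c'Z; apply/allP => r rc'.
  have pr := allP (allP pc _ c'Z) _ rc'.
  have rp : array_le x r p by apply: (allP hZ); apply/flattenP; exists c'.
  rewrite /passes filter_rcons; case: ifP => // h.
  have rep : r = p by apply: (@array_le_anti x); rewrite rp h.
  by move: pr; rewrite rep passes_max ?lp.
have /andP[-> ->] := IH hZ (introT andP (conj gZ pZ)).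
rewrite gc !andbT /=.
have pp : passes x c p by rewrite passes_max ?lp.
(* The columns to the right gain only [p], which passes [c]. *)
elim: (Z) pc {IH gZ hZ pZ} => [|c1 Z1 IH] /=; first by rewrite pp.
move=> /andP[h1 h2]; case: ifP => _ /=; last by rewrite h1 IH.
by rewrite all_rcons pp h1.
Qed.

(** Take a largest [p], in the rightmost column containing it, where it must come last. Entries
    further right strictly precede [p], so removing [p] does not change what they pass; reinserted,
    [p] passes the earlier columns and returns to its own. *)
Lemma is_good_remove x Z : is_good x Z -> Z != [::] ->
  exists Z' p, [/\ is_good x Z', pile_insert x Z' p = Z
                 & all (array_le x ^~ p) (flatten Z')].
Proof.
move=> gZ nZ.
have [p pZ pmax] : exists2 p, p \in flatten Z & all (array_le x ^~ p) (flatten Z).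
  have : flatten Z != [::].
    by case: Z nZ gZ => // -[].
  elim: (flatten Z) => // p s IH _.
  have [->|/IH[q qs qmax]] := eqVneq s [::].
    by exists p; rewrite ?inE //= array_le_refl.
  have [h|h] := orP (array_le_total x p q).
    by exists q; rewrite ?inE ?qs ?orbT //= h.
  exists p; rewrite ?inE ?eqxx //= array_le_refl /=.
  by apply: sub_all qmax => r rq; apply: array_le_trans rq h.
have [Z1 [c [Z2 [eZ pc pZ2]]]] : exists Z1 c Z2,
    [/\ Z = Z1 ++ c :: Z2, p \in c & p \notin flatten Z2].
  elim: (Z) pZ => // c Z0 IH /=; rewrite mem_cat.
  have [/IH[Z1 [c1 [Z2 [-> ? ?]]]] _|nin] := boolP (p \in flatten Z0).
    by exists (c :: Z1), c1, Z2.
  by rewrite orbF => h; exists [::], c, Z0.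
have cE : exists k, c = rcons k p.
  have hc : all (array_le x ^~ p) c.
    by move: pmax; rewrite eZ flatten_cat /= !all_cat => /and3P[].
  have /andP[_ sc] : is_pile x c.
    by move: gZ; rewrite eZ /is_good all_cat /= => /andP[/and3P[]].
  case/lastP: c pc hc sc {eZ} => // k q; rewrite mem_rcons inE => h.
  rewrite all_rcons pairwise_rcons => /andP[qp _] /andP[kq _]; exists k.
  have [->//|npq] := eqVneq p q.
  have {h} pk : p \in k by move: h; rewrite (negPf npq).
  have pq := col_rel_array_le (allP kq _ pk).
  by move: npq; rewrite (@array_le_anti x p q) ?pq ?qp // eqxx.
have {cE} [k cE] := cE; rewrite {}cE in eZ pc *.
move: pmax gZ; rewrite eZ flatten_cat /= !all_cat /is_good all_cat /=.
rewrite pairwise_mid => /and3P[m1 mk m2].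
move=> /andP[/and3P[g1 gk g2] /and3P[h1 h2 h3]].
have Z1p : all (fun c' => ~~ ltx x p.2 (last p c').2) Z1.
  apply/allP => c' c'Z1; rewrite -passes_max.
  - by apply: (allP (allP h1 _ c'Z1)).
  - by apply/allP => r rc'; apply: (allP m1); apply/flattenP; exists c'.
  - by have /andP[] := allP g1 _ c'Z1.
have npass r : r \in flatten Z2 -> ~~ array_le x p r.
  move=> rZ2; apply/negP => pr; move: pZ2.
  by rewrite (@array_le_anti x p r) ?pr ?rZ2 // (allP m2).
have insE Z0 : pile_insert x (Z1 ++ Z0) p = Z1 ++ pile_insert x Z0 p.
  elim: (Z1) Z1p => //= c' Z' IH /andP[/negPf -> ?].
  by rewrite IH.
(* If [p] was alone in its column, nothing stands to its right: such an entry would precede [p] and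
   find the column empty. *)
have [k0|nk] := eqVneq k [::].
  have Z20 : Z2 = [::].
    case: Z2 {h3 eZ m2 pZ2} h2 g2 npass => //= -[|r c'] Z2 //= /andP[/andP[h _] _] _.
    move=> /(_ r); rewrite inE eqxx => /(_ isT) /negPf rp.
    by move: h; rewrite k0 /passes /= rp.
  exists Z1, p; split=> //; first by move: h3; rewrite g1 Z20 cats0.
  by rewrite -[Z1 in LHS]cats0 insE /= Z20 k0.
exists (Z1 ++ k :: Z2), p; split.
- rewrite all_cat /= pairwise_mid g1 g2 h3 !andbT /=; apply/and3P; split.
  + have /andP[_] := gk; rewrite pairwise_rcons => /andP[_ sk].
    by rewrite /is_pile sk andbT; case: (k) nk.
  + by apply: sub_all h1 => c'; rewrite all_rcons => /andP[].
  + apply/allP => c' c'Z2; apply/allP => r rc'.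
    have := allP (allP h2 _ c'Z2) _ rc'.
    rewrite /passes filter_rcons (negPf (npass r _)) //.
    by apply/flattenP; exists c'.
- rewrite insE /= ifT //.
  have /andP[_] := gk; rewrite pairwise_rcons => /andP[ak _].
  case/lastP: k nk ak {h1 h2 gk mk pc eZ} => // k q _.
  by rewrite all_rcons last_rcons => /andP[/andP[]].
- rewrite flatten_cat /= !all_cat m1 m2.
  by move: mk; rewrite all_rcons => /andP[_ ->].
Qed.

Definition pile_insertion x s := foldl (pile_insert x) [::] s.

Lemma perm_pile_insertion x s : perm_eq (flatten (pile_insertion x s)) s.
Proof.
rewrite /pile_insertion; elim/last_ind: s => // s p IH.
rewrite foldl_rcons (perm_trans (perm_pile_insert _ _ _)) //.
by rewrite perm_sym perm_rcons perm_cons perm_sym.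
Qed.

Lemma pile_insertion_good x s :
  sorted (array_le x) s -> is_good x (pile_insertion x s).
Proof.
rewrite sorted_pairwise; last exact: array_le_trans.
rewrite /pile_insertion; elim/last_ind: s => // s p IH.
rewrite foldl_rcons pairwise_rcons => /andP[h1 /IH h2].
apply: is_good_insert => //.
by rewrite (perm_all _ (perm_pile_insertion x s)).
Qed.

Lemma pile_insertion_surj x Z : is_good x Z ->
  exists2 s, sorted (array_le x) s & pile_insertion x s = Z.
Proof.
move: {2}(size (flatten Z)) (leqnn (size (flatten Z))) => n.
elim: n Z => [|n IH] Z le_n gZ.
  case: Z gZ le_n => [|c Z]; first by exists [::].
  by rewrite /is_good /= => /andP[/andP[/andP[]]]; case: c.
have [->|nZ] := eqVneq Z [::]; first by exists [::].
have [Z' [p [gZ' eZ pmax]]] := is_good_remove gZ nZ.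
have szZ : size (flatten Z) = (size (flatten Z')).+1.
  by rewrite -eZ (perm_size (perm_pile_insert x Z' p)).
have [|s ss sZ'] := IH Z' _ gZ'; first by rewrite -ltnS -szZ.
exists (rcons s p); last by rewrite /pile_insertion foldl_rcons -eZ -sZ'.
move: ss; rewrite !(sorted_pairwise (@array_le_trans x)) pairwise_rcons => ->.
by rewrite andbT -(perm_all _ (perm_pile_insertion x s)) sZ'.
Qed.

(** * Passing a column as a condition on adjacent entries *)

Definition avoids x c r : bool :=
  sorted (fun p q => ~~ [&& ltx x r.2 p.2, ltx x r.1 q.1 & ~~ ltx x r.1 p.1]) c.

(** The witness is the entry at the bottom of [c] when [r] arrives: it precedes [r] and is not
    bumped, so [array_leE] bounds both coordinates. *)
Lemma passes_witness x c r : passes x c r ->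
  exists2 p, p \in c & ~~ ltx x r.1 p.1 && ~~ ltx x r.2 p.2.
Proof.
rewrite /passes; case E: [seq p <- c | _] => [|p0 k] //= lp.
exists (last p0 k); first by
  apply: (@mem_subseq _ [seq p <- c | array_le x p r] c (filter_subseq _ _));
  rewrite E mem_last.
have : last p0 k \in [seq p <- c | array_le x p r] by rewrite E mem_last.
by rewrite mem_filter array_leE (negPf lp) andbT => /andP[].
Qed.

(** Along a pile first coordinates grow and second ones drop, so the bounds at the witness carry
    over to the head here and to the last entry in [passes_last]. These yield the bottom-row
    conditions of Q and of P. *)
Lemma passes_head x h c r : pairwise (col_rel x) (h :: c) ->
  passes x (h :: c) r -> ~~ ltx x r.1 h.1.
Proof.
move=> /andP[hc _] /passes_witness[p + /andP[np _]].
rewrite inE => /orP[/eqP <- //|/(allP hc)/andP[hp _]].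
by apply: contra np => rh; apply: ltx_trans rh hp.
Qed.

Lemma passes_last x c l r : pairwise (col_rel x) (rcons c l) ->
  passes x (rcons c l) r -> ~~ ltx x r.2 l.2.
Proof.
rewrite pairwise_rcons => /andP[hc _] /passes_witness[p + /andP[_ np]].
rewrite mem_rcons inE => /orP[/eqP <- //|/(allP hc)/andP[_ hp]].
by apply: contra np => rh; apply: ltx_trans rh hp.
Qed.

(** Cut [c] at the witness: up to it [r] is not below any first coordinate, from it on not below any
    second one, so no adjacent pair meets both conditions. This is stronger than [avoids], and makes
    avoidance of (312,231) automatic. *)
Lemma passes_sorted x c r : pairwise (col_rel x) c -> passes x c r ->
  sorted (fun p q => ~~ (ltx x r.2 p.2 && ltx x r.1 q.1)) c.
Proof.
move=> sc /passes_witness[p pc /andP[n1 n2]].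
case/path.splitPr: pc sc => c1 c2 sc.
have : sorted (col_rel x) (c1 ++ p :: c2).
  by rewrite sorted_pairwise //; apply: col_rel_trans.
rewrite !sorted_cat_cons => /andP[s1 s2]; apply/andP; split.
  apply: (@sub_in_sorted _ (fun q => ~~ ltx x r.1 q.1)) s1.
    by move=> q q' _ hq' _; rewrite negb_and; apply/orP; right.
  rewrite all_rcons n1; apply/allP => q qc1.
  move: sc; rewrite pairwise_cat allrel_consr => /and3P[/andP[/allP h _] _ _].
  have /andP[qp _] := h _ qc1.
  by apply: contra n1 => rq; apply: ltx_trans rq qp.
apply: (@sub_in_sorted _ (fun q => ~~ ltx x r.2 q.2) _ _ _ (p :: c2)) s2.
  by move=> q q' hq _ _; rewrite negb_and; apply/orP; left.
rewrite /= n2; apply/allP => q qc2.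
move: sc; rewrite pairwise_cat /= => /and4P[_ _ /allP h _].
have /andP[_ qp] := h _ qc2.
by apply: contra n2 => rq; apply: ltx_trans rq qp.
Qed.

Lemma passes_avoids x c r :
  pairwise (col_rel x) c -> passes x c r -> avoids x c r.
Proof.
move=> sc /(passes_sorted sc); apply: sub_sorted => p q /=.
by apply: contra => /and3P[-> ->].
Qed.

(** Walk along the column to the first [q] with [ltx x r.1 q.1]. Then [r] arrives between [h] and
    [q], so [h] is at the bottom, and [avoids] says that [r] does not go below it. *)
Lemma avoids_passes x h c r : pairwise (col_rel x) (h :: c) ->
  ~~ ltx x r.1 h.1 -> ~~ ltx x r.2 (last h c).2 -> avoids x (h :: c) r ->
  passes x (h :: c) r.
Proof.
elim: c h => [|q c IH] h /=.
  by move=> _ n1 n2 _; rewrite /passes /= array_leE (negPf n2) n1 /= n2.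
move=> /andP[hc sc] n1 n2 /andP[av avc].
have [rq|nrq] := boolP (ltx x r.1 q.1); last first.
  (* The tail already has an entry preceding [r], so putting [h] in front does not change the last
     such entry. *)
  have := IH q sc nrq n2 avc; rewrite /passes /=.
  by case: ifP => // _; case: ifP => //; case: [seq p <- c | _].
have nrh : ~~ ltx x r.2 h.2 by move: av; rewrite rq n1 !andbT.
rewrite /passes /= array_leE (negPf nrh) n1.
have -> : (if array_le x q r then q :: [seq p <- c | array_le x p r]
            else [seq p <- c | array_le x p r]) =
          [seq p <- q :: c | array_le x p r] by [].
(* No entry from [q] on precedes [r]: its first coordinate is too large, and its second one lies
   below that of [h], which [r] does not bump. *)
have /eq_in_filter -> : {in q :: c, array_le x ^~ r =1 pred0}.
  move=> p pc /=; apply/negP.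
  have /andP[_ ph] : col_rel x h p by apply: (@allP _ _ (q :: c)) pc.
  have rp : ltx x r.1 p.1.
    move: pc; rewrite inE => /orP[/eqP -> //|pc].
    have /andP[/allP /(_ _ pc) /andP[qp _] _] := sc.
    exact: ltx_trans rq qp.
  rewrite array_leE; case: ifP => [rp2 _|_]; last by rewrite rp.
  by move: nrh; rewrite (ltx_trans rp2 ph).
by rewrite filter_pred0 /= nrh.
Qed.

(** * Tableaux read off the columns of pairs *)

Definition P_tableau Z : tableau A := [seq rev (map snd c) | c <- Z].
(** Not reversed, unlike P: a new entry goes on top of its column of Q but to the bottom of its
    column of P. *)
Definition Q_tableau Z : tableau A := [seq map fst c | c <- Z].

(** Empty columns impose nothing, just as [bottom_row] skips them. *)
Definition head_rel (r : rel A) (c c' : seq A) : bool :=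
  if c is a :: _ then if c' is b :: _ then r a b else true else true.

Lemma pairwise_bottom_row (r : rel A) (T : tableau A) :
  pairwise r (bottom_row T) = pairwise (head_rel r) T.
Proof.
elim: T => //= -[|a c] T IH /=; first by rewrite IH all_predT.
by rewrite IH all_pmap; congr andb; apply: eq_all => -[].
Qed.

Lemma is_ps_tableauE x (T : tableau A) :
  is_ps_tableau x T =
  [&& is_composition_diagram T, all (pairwise (ltx x)) T
    & pairwise (head_rel (fun a b => ~~ ltx x b a)) T].
Proof.
rewrite -pairwise_bottom_row -(sorted_pairwise (@nltx_trans x)).
rewrite -(eq_all (sorted_pairwise (@ltx_trans x))).
case: x; congr [&& _, _ & _]; apply: eq_sorted => a b /=.
  by rewrite leNgt.
by rewrite ltNge.
Qed.

Definition is_valid x Z : bool :=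
  [&& is_ps_tableau x (P_tableau Z), is_ps_tableau x (Q_tableau Z)
    & pairwise (fun c c' => all (avoids x c) c') Z].

Lemma is_pileE x c : is_pile x c =
  [&& ~~ nilp c, pairwise (ltx x) (map fst c)
    & pairwise (ltx x) (rev (map snd c))].
Proof. by rewrite /is_pile pairwise_rev !pairwise_map -pairwise_relI. Qed.

Lemma ps_is_pile x Z : is_ps_tableau x (P_tableau Z) ->
  is_ps_tableau x (Q_tableau Z) -> all (is_pile x) Z.
Proof.
rewrite !is_ps_tableauE /is_composition_diagram !all_map.
move=> /and3P[_ h1 _] /and3P[h2 h3 _]; apply/allP => c cZ; rewrite is_pileE.
have := allP h2 _ cZ; rewrite /= /nilp size_map => ->.
by move: (allP h3 _ cZ) (allP h1 _ cZ) => /= -> ->.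
Qed.

(** Both sides are conditions on pairs of columns. Passing gives the bottom-row conditions and
    [avoids]; conversely, the bottom-row conditions concern one entry of [c'] each, and extend to
    all its entries because [c'] is a pile. *)
Lemma is_validE x Z : is_valid x Z = is_good x Z.
Proof.
pose rP c c' := head_rel (fun a b => ~~ ltx x b a)
                  (rev (map snd c)) (rev (map snd c')).
pose rQ c c' := head_rel (fun a b => ~~ ltx x b a) (map fst c) (map fst c').
pose rA c c' := all (avoids x c) c'.
have -> : is_valid x Z = all (is_pile x) Z &&
    pairwise [rel c c' | rP c c' && [rel c c' | rQ c c' && rA c c'] c c'] Z.
  rewrite !pairwise_relI /is_valid !is_ps_tableauE /is_composition_diagram.
  rewrite !pairwise_map !all_map.
  have -> : all (is_pile x) Z =
      [&& all (fun c => ~~ nilp c) Z,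
          all (fun c => pairwise (ltx x) (map fst c)) Z
        & all (fun c => pairwise (ltx x) (rev (map snd c))) Z].
    rewrite -!all_predI; apply: eq_all => c /=; exact: is_pileE.
  have -> : all (preim (fun c => rev (map snd c)) (fun s : seq A => ~~ nilp s)) Z =
      all (fun c => ~~ nilp c) Z.
    by apply: eq_all => c /=; rewrite /nilp size_rev size_map.
  have -> : all (preim (map fst) (fun s : seq A => ~~ nilp s)) Z =
      all (fun c => ~~ nilp c) Z.
    by apply: eq_all => c /=; rewrite /nilp size_map.
  rewrite /rP /rQ /rA /=; case: (all (fun c => ~~ nilp c) Z) => //=.
  by do 2![case: all => //=; rewrite ?andbF //=]; case: pairwise.
rewrite /is_good; have [pZ|//] := boolP (all (is_pile x) Z).
apply/idP/idP; apply: (sub_in_pairwise _ pZ) => c c'.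
- move=> /andP[nc sc] /andP[nc' sc'] /and3P[hP hQ av]; apply/allP => r rc'.
  case: c nc sc hP hQ av => // h c _ sc hP hQ av.
  have {}av : avoids x (h :: c) r by apply: (allP av).
  apply: avoids_passes => //.
    case: c' nc' sc' rc' hQ {hP} => // h' c' _ /= /andP[hc' _].
    rewrite /rQ /= inE => /orP[/eqP -> //|/(allP hc')/andP[hr _]].
    by apply: contra => rh; apply: ltx_trans hr rh.
  case/lastP: c' nc' sc' rc' hP {hQ} => // c' h' _.
  rewrite pairwise_rcons => /andP[hc' _].
  rewrite /rP lastI !map_rcons !rev_rcons /= mem_rcons inE.
  move=> /orP[/eqP -> //|/(allP hc')/andP[_ hr]].
  by apply: contra => rh; apply: ltx_trans hr rh.
- move=> /andP[nc sc] /andP[nc' sc'] /allP hp; apply/and3P; split.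
  + case/lastP: c nc sc hp => // c h _ sc hp.
    case/lastP: c' nc' sc' hp => // c' h' _ _ hp.
    rewrite /rP !map_rcons !rev_rcons /=; apply: (passes_last sc).
    by apply: hp; rewrite mem_rcons inE eqxx.
  + case: c nc sc hp => // h c _ sc hp.
    case: c' nc' sc' hp => // h' c' _ _ hp.
    by rewrite /rQ /=; apply: (passes_head sc); apply: hp; rewrite inE eqxx.
  + by apply/allP => r /hp; apply: passes_avoids.
Qed.

(** * Agreement with the extended insertion *)

Lemma starts_columnE x (P : tableau A) b :
  sorted (fun a b => ~~ ltx x b a) (bottom_row P) ->
  starts_column x P b = ~~ has (ltx x b) (bottom_row P).
Proof.
rewrite (sorted_pairwise (@nltx_trans x)) /starts_column.
case: (bottom_row P) => // a s; cbv beta iota zeta; rewrite lastI.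
set l := last a s; set k := belast a s; rewrite pairwise_rcons => /andP[hk _].
have -> : (if x is Left then l <= b else l < b) = ~~ ltx x b l.
  by case: (x); [apply: leNgt | apply: ltNge].
apply/idP/idP; rewrite has_rcons negb_or; last by case/andP.
(* The bottom row is sorted, so an entry that does not bump its last letter bumps none. *)
move=> bl; rewrite bl; apply/hasPn => e /(allP hk) le.
exact: (nltx_trans le bl).
Qed.

Lemma insert_stepE x Z p : is_good x Z ->
  insert_step x (P_tableau Z, Q_tableau Z) p =
  (P_tableau (pile_insert x Z p), Q_tableau (pile_insert x Z p)).
Proof.
rewrite -is_validE => /and3P[+ _ _].
rewrite is_ps_tableauE -pairwise_bottom_row -(sorted_pairwise (@nltx_trans x)).
move=> /and3P[nZ _ sZ]; case: p => a b; rewrite /insert_step starts_columnE //.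
rewrite /insertion_column.
have -> : (fun e => if x is Left then b < e else b <= e) = ltx x b.
  by case: (x).
move: nZ {sZ}; elim: Z => // c Z IH /= /andP[nc nZ].
case/lastP: c nc => // c q _; rewrite map_rcons rev_rcons /= last_rcons.
rewrite /P_tableau /Q_tableau /=; case: (boolP (ltx x b q.2)) => bq /=.
  by rewrite !map_rcons !rev_rcons.
have := IH nZ; rewrite /P_tableau /Q_tableau.
by case: has => /= -[<- <-]; rewrite !map_rcons !rev_rcons.
Qed.

Lemma ext_insertionE x (w : array A) : sorted (array_le x) (zip w.1 w.2) ->
  let Z := pile_insertion x (zip w.1 w.2) in
  ext_insertion x w = (P_tableau Z, Q_tableau Z).
Proof.
rewrite /ext_insertion /pile_insertion.
elim/last_ind: (zip _ _) => //= s p IH ss.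
have {}ss : sorted (array_le x) s.
  by move: ss; rewrite -cats1 => /cat_sorted2[].
by rewrite !foldl_rcons IH // insert_stepE //; apply: pile_insertion_good.
Qed.

(** * Pairs of tableaux of the same shape, and their readings *)

Lemma PQ_tableau_inj Z Z' :
  P_tableau Z = P_tableau Z' -> Q_tableau Z = Q_tableau Z' -> Z = Z'.
Proof.
elim: Z Z' => [|c Z IH] [|c' Z'] //= [/(can_inj revK) e1 e2] [e3 e4].
rewrite (IH Z') //; congr cons.
by rewrite -[c]zip_unzip -[c']zip_unzip /unzip1 /unzip2 e1 e3.
Qed.

Lemma PQ_tableau_ex (P Q : tableau A) : shape P = shape Q ->
  exists2 Z, P = P_tableau Z & Q = Q_tableau Z.
Proof.
elim: P Q => [|p P IH] [|q Q] //=; first by exists [::].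
move=> [epq /IH[Z -> ->]]; exists (zip q (rev p) :: Z) => /=.
  by rewrite -/(unzip2 _) unzip2_zip ?revK // size_rev epq.
by rewrite -/(unzip1 _) unzip1_zip // size_rev epq.
Qed.

Lemma shape_PQ_tableau Z : shape (P_tableau Z) = shape (Q_tableau Z).
Proof.
rewrite /shape -!map_comp; apply: eq_map => c /=.
by rewrite size_rev !size_map.
Qed.

(** Top to bottom is the order of insertion in P, and also in Q once its columns are reversed; hence
    equal positions in the two words belong to the same entry of [flatten Z]. *)
Lemma column_reading_P Z : column_reading (P_tableau Z) = map snd (flatten Z).
Proof.
rewrite /column_reading map_flatten; congr flatten.
by rewrite /reverse_columns -map_comp; apply: eq_map => c /=; rewrite revK.
Qed.

Lemma flatten_Q Z : flatten (Q_tableau Z) = map fst (flatten Z).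
Proof. by rewrite map_flatten. Qed.

Lemma perm_column_reading (T : tableau A) :
  perm_eq (column_reading T) (flatten T).
Proof. by elim: T => //= c T IH; apply: perm_cat; rewrite ?perm_rev. Qed.

(** * Forbidden patterns in standard tableaux *)

Lemma order_isomorphic3 (a b e : A) (i j k : nat) :
  (a < b) = (i < j)%N -> (b < a) = (j < i)%N -> (a < e) = (i < k)%N ->
  (e < a) = (k < i)%N -> (b < e) = (j < k)%N -> (e < b) = (k < j)%N ->
  order_isomorphic [:: a; b; e] [:: i; j; k].
Proof.
move=> h1 h2 h3 h4 h5 h6; split=> // a0.
by move=> [|[|[|?]]] [|[|[|?]]] //= _ _; rewrite ltxx ltnn.
Qed.

Lemma order_isomorphic3E (a b e : A) (i j k : nat) :
  order_isomorphic [:: a; b; e] [:: i; j; k] ->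
  [/\ (b < a) = (j < i)%N, (e < a) = (k < i)%N & (e < b) = (k < j)%N].
Proof.
by case=> _ /(_ a) h; split; [apply: (h 1 0) | apply: (h 2 0) | apply: (h 2 1)].
Qed.

(** These inequalities are common to the three forbidden pairs: the first letter is largest in 312
    and 321, and the third is below the second in 132 and 231. The proof locates [i], [i.+1] and [k]
    relative to the first column. *)
Lemma good_flatten_avoids Z p0 i k : is_good Left Z ->
  (i.+1 < k)%N -> (k < size (flatten Z))%N ->
  let z := nth p0 (flatten Z) in
  ~ [/\ (z i.+1).2 < (z i).2, (z k).2 < (z i).2 & (z k).1 < (z i.+1).1].
Proof.
elim: Z i k => //= c Z IH i k.
rewrite /is_good /= => /andP[/andP[/andP[nc sc] gZ] /andP[pc pZ]] ik.
rewrite size_cat => kz.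
have pass n : (n < size (flatten Z))%N -> passes Left c (nth p0 (flatten Z) n).
  move=> /(mem_nth p0)/flattenP[c' c'Z]; exact: (allP (allP pc _ c'Z)).
rewrite !nth_cat; have [ic|ci] := ltnP i.+1 (size c).
  rewrite (ltnW ic); have [kc|ck] := ltnP k (size c).
    move=> [_ _]; move/pairwiseP: sc => /(_ p0 i.+1 k ic kc ik)/andP[/= h _].
    by rewrite ltNge (ltW h).
  have := pass (k - size c)%N; rewrite ltn_subLR // => /(_ kz).
  move=> /(passes_sorted sc)/sortedP => /(_ p0 _ ic) /= + [_ h1 h2].
  by rewrite h1 h2.
(* Here [z i] is the last entry of [c] and [z i.+1] the first one after it; [passes_last] forbids
   the descent. *)
have [ic|ci'] := ltnP i (size c).
  have ei : i.+1 = size c by apply/eqP; rewrite eqn_leq ic ci.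
  have := pass 0%N; rewrite ei subnn => /(_ _).
  have iz : (0 < size (flatten Z))%N.
    rewrite lt0n; apply/eqP => z0; move: kz.
    by rewrite z0 addn0 -ei ltnNge (ltnW ik).
  move=> /(_ iz); case/lastP: c nc sc ei {pc pass ci kz ic} => // c l _ sc ei.
  move=> /(passes_last sc) /= nl [].
  have -> : i = size c by move: ei; rewrite size_rcons => -[].
  by rewrite nth_rcons ltnn eqxx (negPf nl).
have ck : (size c <= k)%N by rewrite (leq_trans ci') // ltnW // ltnW.
rewrite ltnNge ck /= subSn //.
apply: IH; first by rewrite /is_good gZ.
  by rewrite -subSn // ltn_sub2r // (leq_ltn_trans ci' (ltnW ik)).
by rewrite ltn_subLR.
Qed.

(** An [r] violating [avoids] lies in a later column than the adjacent pair, hence at a position [k]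
    beyond it. The two inequalities within the pair hold because [c] is a pile. *)
Lemma flatten_avoids Z : all (is_pile Left) Z ->
  (forall p0 i k, (i.+1 < k)%N -> (k < size (flatten Z))%N ->
    let z := nth p0 (flatten Z) in
    ~ [/\ (z i).1 < (z i.+1).1, (z i.+1).2 < (z i).2, (z k).2 < (z i).2,
          (z k).1 < (z i.+1).1 & ~~ ((z k).1 < (z i).1)]) ->
  pairwise (fun c c' => all (avoids Left c) c') Z.
Proof.
elim: Z => //= c Z IH /andP[/andP[_ sc] gZ] av; apply/andP; split; last first.
  apply: IH => // p0 i k ik kz z.
  have := av p0 (size c + i)%N (size c + k)%N.
  rewrite -addnS ltn_add2l size_cat ltn_add2l => /(_ ik kz).
  by rewrite /= !nth_cat !ltnNge !leq_addr /= !addKn.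
apply/allP => c' c'Z; apply/allP => r rc'.
have /(nthP r)[k kz kr] : r \in flatten Z by apply/flattenP; exists c'.
apply/(sortedP r) => i ic; apply/negP => /and3P[/= h1 h2 h3].
have := av r i (size c + k)%N; rewrite size_cat ltn_add2l => /(_ _ kz); apply.
  by rewrite (leq_trans ic) // leq_addr.
rewrite /= !nth_cat ic (ltnW ic) ltnNge leq_addr /= addKn kr.
by have /andP[/= ? ?] := pairwiseP r sc i i.+1 (ltnW ic) ic (ltnSn i).
Qed.

Lemma standard_is_ps (T : tableau A) :
  is_standard_ps_tableau T -> is_ps_tableau Left T.
Proof.
move=> /and4P[h1 _ h2 h3]; apply/and3P; split=> //.
by apply: sub_sorted h3 => a b; apply: ltW.
Qed.

Lemma stable_pairE Z : is_standard_ps_tableau (P_tableau Z) ->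
  is_standard_ps_tableau (Q_tableau Z) ->
  is_stable_pair (P_tableau Z) (Q_tableau Z) <-> is_valid Left Z.
Proof.
move=> sP sQ; rewrite /is_stable_pair column_reading_P.
have -> : column_reading (reverse_columns (Q_tableau Z)) = map fst (flatten Z).
  rewrite /column_reading /reverse_columns -map_comp -flatten_Q.
  by congr flatten; rewrite -[RHS]map_id; apply: eq_map => c /=; rewrite revK.
have nthE p0 (f : A * A -> A) i : (i < size (flatten Z))%N ->
    nth (f p0) (map f (flatten Z)) i = f (nth p0 (flatten Z) i).
  exact: nth_map.
split=> [[_ _ _ [n1 n2 n3]]|vZ].
  rewrite /is_valid !standard_is_ps //=.
  apply: flatten_avoids; first by apply: ps_is_pile; apply: standard_is_ps.
  move=> p0 i k ik kz z [] h1 h2 h3 h4 h5.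
  have iz : (i.+1 < size (flatten Z))%N := ltn_trans ik kz.
  have neq (f : A * A -> A) j : uniq (map f (flatten Z)) -> (j < k)%N ->
      f (z j) != f (z k).
    move=> u jk; have jz := ltn_trans jk kz; rewrite -!nthE // nth_uniq ?size_map //.
    by rewrite ltn_eqF.
  have uP : uniq (map snd (flatten Z)).
    have /and4P[_ + _ _] := sP; rewrite -column_reading_P.
    by rewrite (perm_uniq (perm_column_reading _)).
  have uQ : uniq (map fst (flatten Z)).
    by have /and4P[_ + _ _] := sQ; rewrite flatten_Q.
  have {}h5 : (z i).1 < (z k).1.
    by rewrite lt_neqAle neq //= ?leNgt // ltnW.
  have occ s t : order_isomorphic [:: (z i).2; (z i.+1).2; (z k).2] s ->
      order_isomorphic [:: (z i).1; (z i.+1).1; (z k).1] t ->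
      simultaneous_occurrence (map snd (flatten Z)) (map fst (flatten Z)) s t.
    move=> o1 o2; exists (z k).1, i, k.
    by rewrite !size_map !(nth_map p0) ?(ltnW iz).
  (* The upper letters form 132; the lower ones form 321 or 312 according to this last
     comparison. *)
  case: (ltgtP (z k).2 (z i.+1).2) => h6.
  - apply: n3; apply: occ; apply: order_isomorphic3;
      by rewrite ?(h1, h2, h3, h4, h5, h6, lt_gtF h1, lt_gtF h2, lt_gtF h3,
                   lt_gtF h4, lt_gtF h5, lt_gtF h6).
  - apply: n1; apply: occ; apply: order_isomorphic3;
      by rewrite ?(h1, h2, h3, h4, h5, h6, lt_gtF h1, lt_gtF h2, lt_gtF h3,
                   lt_gtF h4, lt_gtF h5, lt_gtF h6).
  - by move: (neq snd i.+1 uP ik); rewrite h6 eqxx.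
split=> //; first exact: shape_PQ_tableau.
have gZ : is_good Left Z by rewrite -is_validE.
suff H s t : (forall a b e, order_isomorphic [:: a; b; e] s -> b < a /\ e < a) ->
    (forall a b e, order_isomorphic [:: a; b; e] t -> e < b) ->
    ~ simultaneous_occurrence (map snd (flatten Z)) (map fst (flatten Z)) s t.
  by split; apply: H => a b e /order_isomorphic3E[h1 h2 h3];
    rewrite ?h1 ?h2 ?h3.
move=> hs ht [a0 [i [k [ik]]]]; rewrite size_map => kz _.
have iz : (i.+1 < size (flatten Z))%N := ltn_trans ik kz.
(* The default [(a0, a0)] projects to the default [a0] of both words. *)
rewrite !(nthE (a0, a0) snd) ?(ltnW iz) // => /hs[h1 h2].
rewrite !(nthE (a0, a0) fst) ?(ltnW iz) // => /ht h3.
exact: (good_flatten_avoids gZ ik kz (And3 h1 h2 h3)).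
Qed.

End Piles.

(** * Standardization of words and tableaux *)

Section Standardization.
Context {d : Order.disp_t} {A : orderType d}.
Implicit Types (x : side) (s : seq A) (T : tableau A) (X Y : std_letter A).

Lemma size_std_word s : size (std_word s) = size s.
Proof. by rewrite /std_word size_map size_zip size_iota minnn. Qed.

Lemma map_fst_std_word s : map fst (std_word s) = s.
Proof. by rewrite /std_word -map_comp -/(unzip1 _) unzip1_zip // size_iota. Qed.

Lemma std_word_rcons s a :
  std_word (rcons s a) = rcons (std_word s) (a, (count_mem a s).+1).
Proof.
rewrite /std_word size_rcons -addn1 iotaD add0n cats1 zip_rcons ?size_iota //.
rewrite map_rcons /= take_oversize ?size_rcons //.
rewrite -(cats1 s a) count_cat /= eqxx addn0 addn1; congr rcons.
(* An earlier position [i] has [i.+1] at most [size s], so its prefix does not reach the appended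
   letter. *)
apply/eq_in_map => -[b i] /= /(map_f snd) /=; rewrite -/(unzip2 _).
rewrite unzip2_zip ?size_iota // mem_iota add0n => /= lt_is.
by rewrite takel_cat.
Qed.

Lemma std_word_index_le s X : X \in std_word s -> (X.2 <= count_mem X.1 s)%N.
Proof.
case/mapP => -[a i] _ -> /=.
by rewrite -[X in (_ <= count_mem _ X)%N](cat_take_drop i.+1) count_cat leq_addr.
Qed.

Lemma std_word_pairwise s :
  pairwise [rel X Y | (X.1 == Y.1) ==> (X.2 < Y.2)%N] (std_word s).
Proof.
elim/last_ind: s => // s a IH; rewrite std_word_rcons pairwise_rcons IH andbT.
apply/allP => X /std_word_index_le /= le_X; apply/implyP => /eqP eX.
by rewrite ltnS -eX.
Qed.

Lemma uniq_std_word s : uniq (std_word s).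
Proof.
by apply: (pairwise_uniq _ (std_word_pairwise s)) => X /=; rewrite eqxx ltnn.
Qed.

(** Meant for [X] read before [Y] in the column reading: equal letters get increasing indices for l
    and decreasing ones for r, which turns [<] into [ltx x]. *)
Definition std_compatible x X Y : bool :=
  (X != Y) && ((Y < X) == ltx x Y.1 X.1).

Lemma column_reading_std x T : column_reading (std_tableau x T) =
  if x is Left then std_word (column_reading T)
  else rev (std_word (rev (column_reading T))).
Proof.
case: x; rewrite /column_reading /reverse_columns /=.
  rewrite /std_left /reverse_columns -map_comp (eq_map revK) map_id reshapeKr //.
  rewrite size_std_word size_flatten /shape -map_comp.
  by rewrite (eq_map (fun c => size_rev c)).
rewrite /std_right map_rev -rev_flatten reshapeKr.
  by rewrite rev_flatten -map_comp (eq_map revK) map_id.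
by rewrite size_std_word size_flatten /shape map_rev.
Qed.

Lemma map_fst_std x T : map (map fst) (std_tableau x T) = T.
Proof.
case: x => /=.
  rewrite /std_left /reverse_columns -map_comp.
  rewrite (eq_map (fun c => map_rev fst c)) map_comp map_reshape map_fst_std_word.
  have -> : shape T = shape (map rev T).
    by rewrite /shape -map_comp; apply: eq_map => c /=; rewrite size_rev.
  by rewrite flattenK -map_comp (eq_map revK) map_id.
rewrite /std_right map_rev map_reshape map_fst_std_word.
have -> : rev (shape T) = shape (rev T) by rewrite /shape map_rev.
by rewrite flattenK revK.
Qed.

Lemma shape_std x T : shape (std_tableau x T) = shape T.
Proof.
rewrite -[in RHS](map_fst_std x T) /shape -map_comp.
by apply: eq_map => c /=; rewrite size_map.
Qed.

(* Reading T from left to right and top to bottom is the order in which Std_l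
   numbers equal letters, and the reverse of the order used by Std_r. *)
Lemma std_reading_compatible x T :
  pairwise (std_compatible x) (column_reading (std_tableau x T)).
Proof.
rewrite column_reading_std; case: x; last rewrite pairwise_rev.
  apply: sub_pairwise (std_word_pairwise _) => X Y /= h; apply/andP; split.
    by apply: contraTneq h => ->; rewrite eqxx ltnn.
  rewrite ltEprodlexi /=; move: h; case: (ltgtP X.1 Y.1) => //= _ h.
  by rewrite ltEnat /= ltnNge (ltnW h).
apply: sub_pairwise (std_word_pairwise _) => X Y /= h; apply/andP; split.
  by apply: contraTneq h => ->; rewrite eqxx ltnn.
rewrite ltEprodlexi /=; move: h; case: (ltgtP X.1 Y.1) => //= _ h.
by rewrite ltEnat /= h.
Qed.

Lemma std_cross_compatible x T :
  pairwise (fun c c' : seq (std_letter A) => allrel (std_compatible x) c c')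
    (std_tableau x T).
Proof.
have := std_reading_compatible x T.
rewrite /column_reading pairwise_flatten => /andP[_].
rewrite pairwise_map; apply: sub_pairwise => c c' /=.
by move=> /allrelP h; apply/allrelP => X Y Xc Yc; apply: h; rewrite mem_rev.
Qed.

(** In a column the upper entry is read first, so [ltx x] becomes [<]. In the bottom row the left
    entry is read first, and the failure of the converse [ltx x], with distinctness, gives [<]. *)
Lemma std_is_standard x T :
  is_ps_tableau x T -> is_standard_ps_tableau (std_tableau x T).
Proof.
move=> psT; have := std_reading_compatible x T; have := std_cross_compatible x T.
have uR : uniq (flatten (std_tableau x T)).
  rewrite -(perm_uniq (perm_column_reading _)) column_reading_std.
  by case: (x); rewrite ?rev_uniq uniq_std_word.
rewrite /is_standard_ps_tableau uR /=.
move: psT; rewrite -{1}(map_fst_std x T); move: (std_tableau x T) => R.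
rewrite is_ps_tableauE /is_composition_diagram !all_map pairwise_map.
move=> /and3P[h1 h2 h3] cross.
rewrite /column_reading pairwise_flatten => /andP[cols _].
rewrite (sorted_pairwise lt_trans) pairwise_bottom_row; apply/and3P; split.
- by apply: sub_all h1 => c /=; rewrite /nilp size_map.
- apply/allP => c cR; rewrite (sorted_pairwise lt_trans).
  have : pairwise (std_compatible x) (rev c) by apply: (allP cols); apply: map_f.
  have := allP h2 c cR; rewrite /= pairwise_map pairwise_rev => c1 c2.
  have : pairwise [rel X Y | relpre fst (ltx x) X Y && std_compatible x Y X] c.
    by rewrite pairwise_relI c1.
  by apply: sub_pairwise => X Y /= /and3P[hXY _ /eqP ->].
- have : pairwise [rel c c' |
      relpre (map fst) (head_rel (fun a b => ~~ ltx x b a)) c c' &&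
      allrel (std_compatible x) c c'] R.
    by rewrite pairwise_relI h3.
  apply: sub_pairwise => -[|X c] [|Y c'] //= /andP[nYX].
  rewrite allrel_consl /= => /andP[/andP[/andP[nXY /eqP e] _] _].
  by rewrite lt_neqAle nXY leNgt e.
Qed.

(** * Transfer of stability through standardization *)

Definition unstandardize (q : std_letter A * std_letter A) : A * A :=
  (q.1.1, q.2.1).

(** [avoids] compares [r] only with entries of an earlier column, never these with each other, so
    compatibility across columns suffices. *)
Lemma avoids_unstandardize x (Z : seq (seq (std_letter A * std_letter A))) :
  pairwise (fun c c' => allrel (std_compatible x) c c') (P_tableau Z) ->
  pairwise (fun c c' => allrel (std_compatible x) c c') (Q_tableau Z) ->
  pairwise (fun c c' => all (avoids x c) c') (map (map unstandardize) Z) =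
  pairwise (fun c c' => all (avoids Left c) c') Z.
Proof.
elim: Z => //= c Z IH /andP[hP sP] /andP[hQ sQ]; rewrite IH //; congr andb.
rewrite all_map; apply: eq_in_all => c' c'Z /=.
rewrite all_map; apply: eq_in_all => r rc' /=.
rewrite /avoids sorted_map; apply: (@eq_in_sorted _ (mem c)); last exact/allP.
have cP p : p \in c -> (r.2 < p.2) = ltx x r.2.1 p.2.1.
  move=> pc; have /allrelP/(_ p.2 r.2) := allP hP _ (map_f _ c'Z).
  by rewrite !mem_rev !map_f // => /(_ isT isT)/andP[_ /eqP].
have cQ p : p \in c -> (r.1 < p.1) = ltx x r.1.1 p.1.1.
  move=> pc; have /allrelP/(_ p.1 r.1) := allP hQ _ (map_f _ c'Z).
  by rewrite !map_f // => /(_ isT isT)/andP[_ /eqP].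
by move=> p q pc qc /=; rewrite cP ?cQ.
Qed.

Lemma P_unstandardize (Z : seq (seq (std_letter A * std_letter A))) :
  P_tableau (map (map unstandardize) Z) = map (map fst) (P_tableau Z).
Proof.
rewrite /P_tableau -!map_comp; apply: eq_map => c /=.
by rewrite map_rev -!map_comp.
Qed.

Lemma Q_unstandardize (Z : seq (seq (std_letter A * std_letter A))) :
  Q_tableau (map (map unstandardize) Z) = map (map fst) (Q_tableau Z).
Proof.
rewrite /Q_tableau -!map_comp; apply: eq_map => c /=.
by rewrite -!map_comp.
Qed.

Lemma stable_pair_std x (Z : seq (seq (A * A))) :
  is_ps_tableau x (P_tableau Z) -> is_ps_tableau x (Q_tableau Z) ->
  is_stable_pair (std_tableau x (P_tableau Z)) (std_tableau x (Q_tableau Z)) <->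
  is_good x Z.
Proof.
move=> psP psQ; rewrite -is_validE /is_valid psP psQ /=.
have [ZZ eP eQ] : exists2 ZZ, std_tableau x (P_tableau Z) = P_tableau ZZ
    & std_tableau x (Q_tableau Z) = Q_tableau ZZ.
  by apply: PQ_tableau_ex; rewrite !shape_std shape_PQ_tableau.
have eZ : Z = map (map unstandardize) ZZ.
  apply: PQ_tableau_inj; rewrite ?P_unstandardize ?Q_unstandardize.
    by rewrite -eP map_fst_std.
  by rewrite -eQ map_fst_std.
have cP := std_cross_compatible x (P_tableau Z).
have cQ := std_cross_compatible x (Q_tableau Z).
move: (std_is_standard psP) (std_is_standard psQ) cP cQ; rewrite eP eQ.
move=> stP stQ cP cQ; rewrite eZ avoids_unstandardize // stable_pairE //.
by rewrite /is_valid !standard_is_ps.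
Qed.

Lemma semistandard_stable_pairP x (PQ : tableau A * tableau A) :
  is_semistandard_stable_pair x PQ <->
  exists2 Z, is_good x Z & PQ = (P_tableau Z, Q_tableau Z).
Proof.
split=> [|[Z gZ ->]].
  case: PQ => P Q [/= psP psQ sh]; have [Z eP eQ] := PQ_tableau_ex sh.
  rewrite {}eP {}eQ in psP psQ * => /(stable_pair_std psP psQ) gZ.
  by exists Z.
have := gZ; rewrite -is_validE => /and3P[psP psQ _].
by split=> //; [apply: shape_PQ_tableau | apply/stable_pair_std].
Qed.

End Standardization.

Theorem theorem3p8 (d : Order.disp_t) (B : orderType d) (x : side) :
  set_bij (two_rowed_arrays B x) (semistandard_stable_pairs B x)
    (fun w : array B => (Pps x w, Qps x w)).
Proof.
have arrayP (w : array B) : two_rowed_arrays B x w <->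
    size w.1 = size w.2 /\ sorted (array_le x) (zip w.1 w.2).
  rewrite /two_rowed_arrays /= /is_two_rowed_array.
  by split=> [/andP[/eqP]|[-> ->]]; rewrite ?eqxx.
have imageE w : two_rowed_arrays B x w -> (Pps x w, Qps x w) =
    (P_tableau (pile_insertion x (zip w.1 w.2)),
     Q_tableau (pile_insertion x (zip w.1 w.2))).
  by move=> /arrayP[_ sw]; rewrite /Pps /Qps ext_insertionE.
split.
- move=> w hw; rewrite /semistandard_stable_pairs /= imageE //.
  apply/semistandard_stable_pairP.
  exists (pile_insertion x (zip w.1 w.2)) => //.
  by apply: pile_insertion_good; case/arrayP: hw.
- move=> w w' /set_mem hw /set_mem hw'; rewrite !imageE // => -[eP eQ].
  have eZ := PQ_tableau_inj eP eQ.
  have [[sz sw] [sz' sw']] := (proj1 (arrayP _) hw, proj1 (arrayP _) hw').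
  (* Both words are sorted permutations of the entries of one and the same [Z]. *)
  have ez : zip w.1 w.2 = zip w'.1 w'.2.
    apply: (sorted_eq (@array_le_trans _ _ x) (@array_le_anti _ _ x)) => //.
    have := perm_pile_insertion x (zip w.1 w.2); rewrite eZ perm_sym => h.
    exact: perm_trans h (perm_pile_insertion x _).
  have -> : w = (unzip1 (zip w.1 w.2), unzip2 (zip w.1 w.2)).
    by rewrite unzip1_zip ?unzip2_zip ?sz // -surjective_pairing.
  by rewrite ez unzip1_zip ?unzip2_zip ?sz' // -surjective_pairing.
- move=> PQ /semistandard_stable_pairP[Z /pile_insertion_surj[s ss <-] ->].
  have zs : zip (unzip1 s) (unzip2 s) = s by apply: zip_unzip.
  have hs : two_rowed_arrays B x (unzip1 s, unzip2 s).
    by apply/arrayP; rewrite /= zs !size_map.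
  by exists (unzip1 s, unzip2 s) => //; rewrite imageE //= zs.
Qed.
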